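(* Let $\varphi=(\hat u,\hat v)$ be the traveling wave, let $u_i(\lambda,z)$ ($i=1,\dots,4$) be the normalized solutions, and let $D$ be the Evans function, all as described in the context. Write $u_i=u_i(0,z)$ and $\Omega(u_1,u_4)=e^{cz}\omega(u_1(0,z),u_4(0,z))$ (which is independent of $z$). Then $$D'(0)=\Omega(u_1,u_4)\int_{-\infty}^{\infty}e^{cz}\left(\frac{(\hat u')^2}{\sigma}-\frac{(\hat v')^2}{\alpha}\right)dz .$$
   Context: Setting. Let $f,g\in C^2(\mathbb R)$ and $\alpha,\sigma>0$, and consider $u_t=u_{xx}+f(u)-\sigma v$, $v_t=v_{xx}+g(v)+\alpha u$. Here $(0,0)$ is an equilibrium with $f'(0)+g'(0)<0$ and $f'(0)g'(0)+\sigma\alpha>0$. The system has a traveling wave $\varphi=(\hat u,\hat v)$ of speed $c$, a nonconstant solution depending only on $z=x-ct$ and decaying exponentially to $(0,0)$ as $z\to\pm\infty$. Thus, also writing $\varphi=(\hat u,\hat v,\hat u'/\sigma,\hat v'/\alpha)$, $\varphi$ is an orbit homoclinic to $0\in\mathbb R^4$ of the system (TW): $u'=\sigma w$, $v'=\alpha y$, $w'=-cw-f(u)/\sigma+v$, $y'=-cy-u-g(v)/\alpha$. Let $\nu_1,\nu_2$ be the eigenvalues of $\begin{pmatrix}f'(0)&-\sigma\\ \alpha&g'(0)\end{pmatrix}$. Standing assumptions: (A1) $c<0$. (A2) $\nu_1,\nu_2$ are real and simple, with $\nu_1<\nu_2<0$. For real $\lambda>\nu_2$ set $\mu_{1}(\lambda)=-\frac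 c2-\frac12\sqrt{c^2+4(\lambda-\nu_1)}$, $\mu_{2}(\lambda)=-\frac c2-\frac12\sqrt{c^2+4(\lambda-\nu_2)}$, $\mu_{3}(\lambda)=-\frac c2+\frac12\sqrt{c^2+4(\lambda-\nu_2)}$, $\mu_{4}(\lambda)=-\frac c2+\frac12\sqrt{c^2+4(\lambda-\nu_1)}$. (A3) The exponential decay rate of $\varphi$ is exactly $\mu_2(0)$ as $z\to+\infty$ and exactly $\mu_3(0)$ as $z\to-\infty$. (A4) $\varphi$ is transversely constructed: for (TW) augmented with $c'=0$ (in $\mathbb R^5$), the curve $(\varphi(z),c)$ is given by the transverse intersection of the center-unstable and center-stable manifolds of the fixed point $(0,0,0,0,c)$. Linearized system. For $\lambda\in\mathbb R$ consider $Y'=A(\lambda,z)Y$ on $\mathbb R^4$ with $$A(\lambda,z)=\begin{pmatrix}0&0&\sigma&0\\0&0&0&\alpha\\ \frac{\lambda-f'(\hat u(z))}{\sigma}&1&-c&0\\-1&\frac{\lambda-g'(\hat v(z))}{\alpha}&0&-c\end{pmatrix},\qquad A_\infty(\lambda)=\lim_{z\to\pm\infty}A(\lambda,z).$$ The eigenvalues of $A_\infty(\lambda)$ are $\mu_1(\lambda),\dots,\mu_4(\lambda)$. Fix $\delta>0$ small so that on $I=[-\delta,\infty)$ these are real and simple with $\mu_1<\mu_2<0<\mu_3<\mu_4$. For $\lambda\in I$, $u_i(\lambda,z)$ are solutions of $Y'=A(\lambda,z)Y$, analytic in $\lambda$, with $\lim_{z\to+\infty}e^{-\mu_i(\lambda)z}u_i(\lambda,z)=\eta_i(\lambda)$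 for $i=1,2$ and $\lim_{z\to-\infty}e^{-\mu_i(\lambda)z}u_i(\lambda,z)=\eta_i(\lambda)$ for $i=3,4$, uniformly on compact subsets of $I$, where $\eta_i(\lambda)$ is a nonzero eigenvector of $A_\infty(\lambda)$ for $\mu_i(\lambda)$. Normalization: $u_2(0,z)=u_3(0,z)=\varphi'(z)=(\hat u',\hat v',\hat u''/\sigma,\hat v''/\alpha)$ and $\det[\eta_1(0),\eta_2(0),\eta_3(0),\eta_4(0)]=\rho>0$. Evans function: for $\lambda\in I$, $D(\lambda)\,e_1\wedge e_2\wedge e_3\wedge e_4=e^{2cz}\,u_1(\lambda,z)\wedge u_2(\lambda,z)\wedge u_3(\lambda,z)\wedge u_4(\lambda,z)$, i.e. $D(\lambda)=e^{2cz}\det[u_1,u_2,u_3,u_4]$, which is independent of $z$. Symplectic forms on $\mathbb R^4$: $\omega(a,b)=(a_1b_3-a_3b_1)-(a_2b_4-a_4b_2)$, and $\Omega=e^{cz}\omega$. If $u,v$ solve $Y'=A(\lambda,z)Y$ for the same $\lambda$, then $\Omega(u,v)=e^{cz}\omega(u(z),v(z))$ is independent of $z$. *)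

(* Defs.v *)
(* MathComp / MathComp-Analysis, over an arbitrary R : realType. *)
From HB Require Import structures.
From mathcomp Require Export all_boot all_order all_algebra.
From mathcomp Require Export all_classical all_reals all_analysis.
Set Implicit Arguments.
Unset Strict Implicit.
Unset Printing Implicit Defensive.
Export Order.TTheory GRing.Theory Num.Theory.
Export numFieldNormedType.Exports.
Local Open Scope ring_scope.
Local Open Scope classical_set_scope.

Definition colv (R : realType) (n : nat) (s : seq R) : 'cV[R]_n :=
  \col_(i < n) s`_i.

Definition rows_mx (R : realType) (m n : nat) (s : seq (seq R)) : 'M[R]_(m, n) :=
  \matrix_(i < m, j < n) (nth [::] s i)`_j.

Definition C2 (R : realType) (f : R -> R) : Prop :=
  [/\ forall x, derivable f x 1,
      forall x, derivable (derive1 f) x 1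
    & continuous (derive1 (derive1 f) : R -> R)].

(* Real-analyticity relative to the interval [I]: near each point of [I] the
   function agrees on [I] with a convergent power series (one-sided at an
   endpoint belonging to [I]). *)
Definition analytic_on (R : realType) (V : normedModType R)
    (I : set R) (h : R -> V) : Prop :=
  forall l0, I l0 -> exists (r : R) (a : nat -> V), 0 < r /\
    forall l, I l -> `|l - l0| < r ->
      series (fun k => (l - l0) ^+ k *: a k) @ \oo --> h l.

(* Classical solutions, [u x t] and [v x t], of the reaction-diffusion system
   u_t = u_xx + f(u) - sigma v,  v_t = v_xx + g(v) + alpha u. *)
Definition rd_solution (R : realType) (f g : R -> R) (alpha sigma : R)
    (u v : R -> R -> R) : Prop :=
  (forall x t,
    [/\ derivable (u x) t 1, derivable (u ^~ t) x 1
      & derivable (derive1 (u ^~ t)) x 1]) /\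
  (forall x t,
    [/\ derivable (v x) t 1, derivable (v ^~ t) x 1
      & derivable (derive1 (v ^~ t)) x 1]) /\
  (forall x t,
    derive1 (u x) t =
      derive1 (derive1 (u ^~ t)) x + f (u x t) - sigma * v x t) /\
  (forall x t,
    derive1 (v x) t =
      derive1 (derive1 (v ^~ t)) x + g (v x t) + alpha * u x t).

Definition exp_decay (R : realType) (h : R -> R) : Prop :=
  exists K kappa : R, 0 < kappa /\
    forall z, `|h z| <= K * expR (- kappa * `|z|).

Definition travelling_wave (R : realType) (f g : R -> R) (alpha sigma c : R)
    (uh vh : R -> R) : Prop :=
  [/\ rd_solution f g alpha sigma
        (fun x t => uh (x - c * t)) (fun x t => vh (x - c * t)),
      exists z1 z2, (uh z1, vh z1) <> (uh z2, vh z2),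
      exp_decay uh & exp_decay vh].

Definition phi (R : realType) (alpha sigma : R) (uh vh : R -> R) (z : R) :
    'cV[R]_4 :=
  colv 4 [:: uh z; vh z; derive1 uh z / sigma; derive1 vh z / alpha].

Definition dphi (R : realType) (alpha sigma : R) (uh vh : R -> R) (z : R) :
    'cV[R]_4 :=
  colv 4 [:: derive1 uh z; derive1 vh z;
           derive1 (derive1 uh) z / sigma; derive1 (derive1 vh) z / alpha].

Definition lin0 (R : realType) (f g : R -> R) (alpha sigma : R) : 'M[R]_2 :=
  rows_mx 2 2 [:: [:: derive1 f 0; - sigma]; [:: alpha; derive1 g 0]].

Definition mu_minus (R : realType) (c nu lam : R) : R :=
  - c / 2 - Num.sqrt (c ^+ 2 + 4 * (lam - nu)) / 2.

Definition mu_plus (R : realType) (c nu lam : R) : R :=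
  - c / 2 + Num.sqrt (c ^+ 2 + 4 * (lam - nu)) / 2.

Definition A_mx (R : realType) (f g : R -> R) (alpha sigma c : R)
    (uh vh : R -> R) (lam z : R) : 'M[R]_4 :=
  rows_mx 4 4
    [:: [:: 0; 0; sigma; 0];
        [:: 0; 0; 0; alpha];
        [:: (lam - derive1 f (uh z)) / sigma; 1; - c; 0];
        [:: -1; (lam - derive1 g (vh z)) / alpha; 0; - c]].

Definition omega (R : realType) (a b : 'cV[R]_4) : R :=
  (a 0 0 * b 2 0 - a 2 0 * b 0 0) - (a 1 0 * b 3 0 - a 3 0 * b 1 0).

Definition Omega (R : realType) (c : R) (u v : R -> 'cV[R]_4) (z : R) : R :=
  expR (c * z) * omega (u z) (v z).

Definition det4 (R : realType) (a1 a2 a3 a4 : 'cV[R]_4) : R :=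
  \det (row_mx a1 (row_mx a2 (row_mx a3 a4))).

(* The Evans function, read off at [z]; its value does not depend on [z]. *)
Definition evans (R : realType) (c : R) (u1 u2 u3 u4 : R -> R -> 'cV[R]_4)
    (z lam : R) : R :=
  expR (2 * c * z) * det4 (u1 lam z) (u2 lam z) (u3 lam z) (u4 lam z).

(* On the parameter interval [I], [u] is a family of solutions of Y' = A Y,
   analytic in the parameter, with exp(- mu z) u asymptotic, along the filter
   [F] in z (+oo or -oo) and locally uniformly in the parameter, to an
   eigenvector [eta] of [Ainf] for [mu]. *)
Definition asymptotic_solution (R : realType) (I : set R) (F : set_system R)
    (A : R -> R -> 'M[R]_4) (Ainf : R -> 'M[R]_4) (mu : R -> R)
    (u : R -> R -> 'cV[R]_4) (eta : R -> 'cV[R]_4) : Prop :=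
  [/\ forall lam, I lam -> forall z : R,
        is_derive z 1 (u lam) (A lam z *m u lam z),
      forall z, analytic_on I (u ^~ z),
      forall lam, I lam ->
        eta lam != 0 /\ Ainf lam *m eta lam = mu lam *: eta lam
    & forall K : set R, compact K -> K `<=` I ->
        {uniform K, (fun z lam => expR (- mu lam * z) *: u lam z) @ F --> eta}].

(* Invariant manifolds of x' = F x at an equilibrium p.  Everything is stated
   for the stable direction; the unstable one is obtained from \- F. *)
Section invariant_manifolds.
Variables (R : realType) (n : nat).
Notation V := 'cV[R]_n.
Implicit Types (F : V -> V) (M U : set V) (p x : V).

Definition C1_on (k : nat) U (G : V -> 'cV[R]_k) : Prop :=
  (forall x, U x -> differentiable G x) /\
  forall (v : V) x, U x -> {for x, continuous (fun y => 'd G y v)}.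

Definition C1_submanifold (k : nat) M : Prop :=
  forall x, M x -> exists U (G : V -> 'cV[R]_k),
    [/\ open U, U x, C1_on U G,
        forall y, U y -> range ('d G y) = setT
      & M `&` U = U `&` G @^-1` [set 0]].

(* Velocities of curves in M through x: the tangent space if M is a
   C^1 submanifold. *)
Definition tangent M x : set V :=
  [set v | exists gam : R -> V,
    [/\ gam 0 = x, is_derive (0 : R) 1 gam v & \forall s \near 0, M (gam s)]].

Definition solution_on F (a b : R) (X : R -> V) : Prop :=
  forall t, a <= t <= b -> is_derive t 1 X (F (X t)).

(* Span of the eigenvectors of DF(p) with eigenvalue <= 0.  This is the
   center-stable subspace when DF(p) is diagonalizable over the reals, as for
   the system to which it is applied below (simple spectrum mu_i(0), 0). *)
Definition center_stable_space F p : set V :=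
  [set v | exists (m : nat) (a : 'I_m -> R) (w : 'I_m -> V),
    (forall k, a k <= 0 /\ 'd F p (w k) = a k *: w k) /\ v = \sum_k w k].

(* A local center-stable manifold: a C^1 submanifold through p, tangent to the
   center-stable subspace at p, and invariant relative to a neighborhood. *)
Definition local_center_stable_manifold F p M : Prop :=
  exists (k : nat) U,
    [/\ open U, U p, M `<=` U & M p] /\
    [/\ C1_submanifold k M,
        tangent M p = center_stable_space F p
      & forall (a b : R) (X : R -> V), solution_on F a b X ->
          (forall t, a <= t <= b -> U (X t)) ->
          (exists2 t, a <= t <= b & M (X t)) ->
          forall t, a <= t <= b -> M (X t)].

(* Preimage of M under the time-T flow. *)
Definition flow_preimage F M (T : R) : set V :=
  [set x | exists X : R -> V, [/\ solution_on F 0 T X, X 0 = x & M (X T)]].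

(* The global manifold is the union of the flow preimages of a local one.
   It is only immersed, so its tangent space at x is taken along the sheets
   [flow_preimage F M T], which agree near x for large T. *)
Definition center_stable_manifold F M : set V :=
  [set x | exists2 T : R, 0 <= T & flow_preimage F M T x].

Definition center_stable_tangent F M x : set V :=
  [set v | \forall T \near +oo%R, tangent (flow_preimage F M T) x v].

Definition transverse_connection F p (gam : R -> V) : Prop :=
  exists Mcs Mcu : set V,
    [/\ local_center_stable_manifold F p Mcs,
        local_center_stable_manifold (\- F) p Mcu
      & forall z,
        [/\ center_stable_manifold F Mcs (gam z),
            center_stable_manifold (\- F) Mcu (gam z)
          & forall v, exists a b,
            [/\ center_stable_tangent F Mcs (gam z) a,
                center_stable_tangent (\- F) Mcu (gam z) b
              & v = a + b]]].

End invariant_manifolds.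

(* The travelling wave system augmented with c' = 0, in the variables
   (u, v, w, y, c). *)
Definition tw_field (R : realType) (f g : R -> R) (alpha sigma : R)
    (X : 'cV[R]_5) : 'cV[R]_5 :=
  let u := X 0 0 in let v := X 1 0 in let w := X 2 0 in
  let y := X 3 0 in let c := X 4 0 in
  colv 5 [:: sigma * w;
             alpha * y;
             - c * w - f u / sigma + v;
             - c * y - u - g v / alpha;
             0].

Definition transversely_constructed (R : realType) (f g : R -> R)
    (alpha sigma c : R) (uh vh : R -> R) : Prop :=
  transverse_connection (tw_field f g alpha sigma)
    (colv 5 [:: 0; 0; 0; 0; c])
    (fun z =>
      colv 5 [:: uh z; vh z; derive1 uh z / sigma; derive1 vh z / alpha; c]).

(* Main.v *)
(* At lambda = 0 the solutions u2 and u3 coincide with phi', so D(0) = 0.  As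
   [omega /\ omega] is a volume form, D is the Pfaffian
     Omega(u1,u2) Omega(u3,u4) - Omega(u1,u3) Omega(u2,u4) + Omega(u1,u4) Omega(u2,u3).
   At lambda = 0 the constants Omega(u1,u2) and Omega(u3,u4) vanish, by letting
   z tend to +oo and -oo respectively; as u2 = u3 there, the first two products
   vanish to second order, and D'(0) = Omega(u1,u4) (G2 - G3), where G_i is the
   lambda-derivative of Omega(u_i(lambda), phi') at 0.  For every lambda,
     d/dz Omega(u_i(lambda), phi') = - lambda * e^{cz} (...),
   a density that tends to the integrand h as lambda tends to 0; hence
   G_i' = - h.  Finally G2 vanishes at +oo and G3 at -oo, so that the constant
   G2 - G3 is the integral of h.
   The asymptotics are uniform only in a real parameter, and therefore cannot be
   differentiated in lambda.  The decay of G_i is instead obtained by integrating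
   the displayed equation, divided by lambda, from z to infinity with bounds
   uniform in lambda, before letting lambda tend to 0. *)

Require Import Defs.
From mathcomp Require Import all_boot all_order all_algebra.
From mathcomp Require Import all_classical all_reals all_analysis.
From mathcomp Require Import measurable_realfun ring lra.
Import Order.TTheory GRing.Theory Num.Theory.
Import numFieldNormedType.Exports.
Local Open Scope ring_scope.
Local Open Scope classical_set_scope.
Set Implicit Arguments.
Unset Strict Implicit.
Unset Printing Implicit Defensive.

(** * The symplectic form and the determinant *)

Lemma sum_ord4 (V : nmodType) (F : 'I_4 -> V) :
  \sum_(k < 4) F k = F 0 + F 1 + F 2 + F 3.
Proof.
rewrite 4!big_ord_recl big_ord0 addr0 !addrA.
by congr (F _ + F _ + F _ + F _); exact/val_inj.
Qed.

Lemma forall_ord4 (P : 'I_4 -> Prop) :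
  P 0 -> P 1 -> P 2 -> P 3 -> forall i, P i.
Proof.
move=> P0 P1 P2 P3 [[|[|[|[|//]]]] i4].
- by rewrite (_ : Ordinal i4 = 0); last exact/val_inj.
- by rewrite (_ : Ordinal i4 = 1); last exact/val_inj.
- by rewrite (_ : Ordinal i4 = 2); last exact/val_inj.
- by rewrite (_ : Ordinal i4 = 3); last exact/val_inj.
Qed.

Lemma A_mx_mulE (R : realType) (f g : R -> R) (alpha sigma c : R) (uh vh : R -> R)
  (lam z : R) (v : 'cV[R]_4) :
  A_mx f g alpha sigma c uh vh lam z *m v = colv 4 [:: sigma * v 2 0; alpha * v 3 0;
   (lam - derive1 f (uh z)) / sigma * v 0 0 + v 1 0 - c * v 2 0;
   - v 0 0 + (lam - derive1 g (vh z)) / alpha * v 1 0 - c * v 3 0].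
Proof.
apply/matrixP => i j; rewrite (ord1 j) {j} !mxE sum_ord4 !mxE.
by elim/forall_ord4: i => /=; ring.
Qed.

Lemma det_mx33 (R : comNzRingType) (M : 'M[R]_3) :
  \det M = M 0 0 * (M 1 1 * M 2 2 - M 1 2 * M 2 1)
         - M 0 1 * (M 1 0 * M 2 2 - M 1 2 * M 2 0)
         + M 0 2 * (M 1 0 * M 2 1 - M 1 1 * M 2 0).
Proof.
(* Indexing the entries by natural numbers lets the indices produced by [lift] in the cofactors
   compute, so that [ring] recognizes equal entries. *)
pose m i j := M (inord i) (inord j).
have mE i j : M i j = m i j by rewrite /m !inord_val.
rewrite !mE.
rewrite (expand_det_row _ ord0) 3!big_ord_recl big_ord0 /cofactor.
rewrite !(expand_det_row _ ord0) !(big_ord_recl 1) !(big_ord_recl 0) !big_ord0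
  /cofactor !det_mx11.
rewrite !mxE !mE /= /bump /=.
by ring.
Qed.

(* The right-hand side is the Pfaffian of the Gram matrix of [omega] on the four
   vectors, i.e. [(omega /\ omega) / 2] evaluated on them. *)
Lemma det4E (R : realType) (a b d e : 'cV[R]_4) :
  det4 a b d e = omega a b * omega d e - omega a d * omega b e + omega a e * omega b d.
Proof.
rewrite /det4 /omega.
have -> : row_mx a (row_mx b (row_mx d e)) = rows_mx 4 4
  [:: [:: a 0 0; b 0 0; d 0 0; e 0 0];
      [:: a 1 0; b 1 0; d 1 0; e 1 0];
      [:: a 2 0; b 2 0; d 2 0; e 2 0];
      [:: a 3 0; b 3 0; d 3 0; e 3 0]].
  apply/matrixP => i j; rewrite [RHS]mxE mxE.
  case: splitP => k; rewrite ?ord1 => ->; first by elim/forall_ord4: i.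
  rewrite mxE; case: splitP => l; rewrite ?ord1 => ->; first by elim/forall_ord4: i.
  rewrite mxE; case: splitP => m; rewrite ?ord1 => ->; by elim/forall_ord4: i.
rewrite (expand_det_row _ ord0) sum_ord4 /cofactor !det_mx33.
rewrite !mxE /= /bump /=.
by ring.
Qed.

Lemma is_derive_coord (R : realType) (m n : nat) (M : R -> 'M[R]_(m, n)) (t : R) dM i j :
  is_derive t 1 M dM -> is_derive t 1 (fun x => M x i j) (dM i j).
Proof.
move=> [dM1 <-]; split; first by have /derivable_mxP := dM1.
by rewrite derive_mx // mxE.
Qed.

Lemma is_derive_omega (R : realType) (a b : R -> 'cV[R]_4) (t : R) da db :
  is_derive t 1 a da -> is_derive t 1 b db ->
  is_derive t 1 (fun s => omega (a s) (b s)) (omega da (b t) + omega (a t) db).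
Proof.
move=> ha hb.
have A i := is_derive_coord i 0 ha; have B i := is_derive_coord i 0 hb.
rewrite /omega; apply: is_derive_eq.
rewrite /GRing.scale /=; ring.
Qed.

Lemma is_derive_Omega (R : realType) (c : R) (a b : R -> 'cV[R]_4) (t : R) da db :
  is_derive t 1 a da -> is_derive t 1 b db ->
  is_derive t 1 (Omega c a b)
    (expR (c * t) * (c * omega (a t) (b t) + omega da (b t) + omega (a t) db)).
Proof.
move=> ha hb.
have H := is_derive_omega ha hb.
rewrite /Omega; apply: is_derive_eq.
rewrite /GRing.scale /=; ring.
Qed.
(** The rate of change of Omega(a, b) in z per unit of difference between the spectral parameters of
    b and a; for a = b = phi' it is the integrand of the theorem. *)
Definition Omega_density (R : realType) (sigma alpha c : R)
    (a b : R -> 'cV[R]_4) (z : R) : R :=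
  expR (c * z) * (a z 0 0 * b z 0 0 / sigma - a z 1 0 * b z 1 0 / alpha).

(** The weight e^{cz} absorbs the damping entries -c. The couplings 1 and -1 cancel because [omega]
    takes its two planes with opposite signs, and the terms in f' and g' cancel by symmetry. Only
    the entries carrying the spectral parameter survive. *)
Lemma is_derive_Omega_solutions (R : realType) (f g : R -> R)
    (alpha sigma c : R) (uh vh : R -> R) (l m : R) (a b : R -> 'cV[R]_4) (z : R) :
  is_derive z 1 a (A_mx f g alpha sigma c uh vh l z *m a z) ->
  is_derive z 1 b (A_mx f g alpha sigma c uh vh m z *m b z) ->
  is_derive z 1 (Omega c a b) ((m - l) * Omega_density sigma alpha c a b z).
Proof.
move=> ha hb; have H := is_derive_Omega c ha hb.
apply: is_derive_eq; rewrite !A_mx_mulE /omega /Omega_density !mxE /=; ring.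
Qed.

(** * Mean value estimates *)

Lemma norm_coord_le (R : realType) (m n : nat) (v : 'M[R]_(m, n)) i j :
  `|v i j| <= `|v|.
Proof.
rewrite [leRHS]/Num.Def.normr /= mx_normrE.
exact: (le_bigmax _ (fun ij => `|v ij.1 ij.2|) (i, j)).
Qed.

Lemma le_norm_coord (R : realType) (m n : nat) (v : 'M[R]_(m, n)) e :
  0 <= e -> (forall i j, `|v i j| <= e) -> `|v| <= e.
Proof.
by move=> e0 ve; rewrite [leLHS]/Num.Def.normr /= mx_normrE bigmax_le.
Qed.

Lemma omega_le (R : realType) (a b : 'cV[R]_4) : `|omega a b| <= 4 * (`|a| * `|b|).
Proof.
have H i j : `|a i 0 * b j 0| <= `|a| * `|b|.
  by rewrite normrM ler_pM // norm_coord_le.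
rewrite /omega.
have := H 0 2; have := H 2 0; have := H 1 3; have := H 3 1.
rewrite !ler_norml => /andP[? ?] /andP[? ?] /andP[? ?] /andP[? ?].
apply/andP; split; lra.
Qed.

Lemma mvt_le (R : realType) (F dF : R -> R) (s t M : R) : 
  (forall x, Num.min s t <= x <= Num.max s t -> is_derive x 1 F (dF x)) ->
  (forall x, Num.min s t <= x <= Num.max s t -> `|dF x| <= M) ->
  `|F t - F s| <= M * `|t - s|.
Proof.
wlog st : s t / s <= t.
  move=> H; have /orP[/H//|ts] := le_total s t.
  by rewrite (minC s) (maxC s) => h1 h2; rewrite distrC (distrC t); exact: H.
rewrite (min_l st) (max_r st) => dF1 dFM.
have dF' x : x \in `]s, t[%R -> is_derive x 1 F (dF x).
  by rewrite in_itv /= => /andP[/ltW sx /ltW xt]; apply: dF1; rewrite sx.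
have cF : {within `[s, t], continuous F}.
  apply: derivable_within_continuous => x; rewrite in_itv /= => xst.
  by have [] := dF1 _ xst.
have [x] := MVT_segment st dF' cF.
by rewrite in_itv /= => xst ->; rewrite normrM ler_wpM2r // dFM.
Qed.

(** The matrix norm is the largest absolute value of an entry, so the scalar estimate applied
    entrywise keeps its constant. *)
Lemma mvt_mx_le (R : realType) (m n : nat) (F dF : R -> 'M[R]_(m, n)) (s t M : R) :
  0 <= M ->
  (forall x, Num.min s t <= x <= Num.max s t -> is_derive x 1 F (dF x)) ->
  (forall x, Num.min s t <= x <= Num.max s t -> `|dF x| <= M) ->
  `|F t - F s| <= M * `|t - s|.
Proof.
move=> M0 dF1 dFM; apply: le_norm_coord => [|i j]; first by rewrite mulr_ge0.
rewrite !mxE.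
apply: (@mvt_le _ (fun x => F x i j) (fun x => dF x i j)) => x xst.
  exact/is_derive_coord/dF1.
exact: le_trans (norm_coord_le _ _ _) (dFM _ xst).
Qed.

(* The maximum M of |X| on the interval satisfies M <= |X y| + K r M. *)
Lemma short_time_bound (R : realType) (n : nat) (X dX : R -> 'cV[R]_n) (y r K : R) :
  0 < r -> 0 <= K ->
  K * r <= 1 / 2 ->
  (forall x, `|x - y| <= r -> is_derive x 1 X (dX x)) ->
  (forall x, `|x - y| <= r -> `|dX x| <= K * `|X x|) ->
  forall x, `|x - y| <= r -> `|X x| <= 2 * `|X y|.
Proof.
move=> r0 K0 Kr dX1 dXK.
have itvE x : (x \in `[y - r, y + r]%R) = (`|x - y| <= r).
  by rewrite in_itv /= ler_distl.
have cX : {within `[y - r, y + r], continuous X}.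
  by apply: derivable_within_continuous => x; rewrite itvE => /dX1[].
have cnX : {within `[y - r, y + r], continuous (fun x => `|X x|)}.
  by move=> x; apply: continuous_comp; [exact: cX|exact: norm_continuous].
have yr : y - r <= y + r by lra.
have [x0 x0r max] := EVT_max yr cnX.
rewrite itvE in x0r.
have sub x : Num.min y x0 <= x <= Num.max y x0 -> `|x - y| <= r.
  move: x0r; rewrite !ler_norml.
  by case: (leP y x0) => ? /andP[? ?] /andP[? ?]; apply/andP; split; lra.
have M0 : 0 <= K * `|X x0| by rewrite mulr_ge0.
have := @mvt_mx_le _ _ _ X dX y x0 _ M0 (fun x h => dX1 x (sub x h)).
have dXM x : Num.min y x0 <= x <= Num.max y x0 -> `|dX x| <= K * `|X x0|.
  move=> /sub xr; apply: le_trans (dXK _ xr) _; rewrite ler_wpM2l //.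
  by apply: max; rewrite itvE.
move=> /(_ dXM) H x xr.
apply: (@le_trans _ _ `|X x0|); first by apply: max; rewrite itvE.
have : `|X x0| - `|X y| <= `|X x0 - X y| by exact: lerB_dist.
have : K * `|X x0| * `|x0 - y| <= `|X x0| / 2.
  apply: (@le_trans _ _ (K * `|X x0| * r)); first by rewrite ler_wpM2l.
  rewrite mulrAC; have := ler_wpM2r (normr_ge0 (X x0)) Kr; lra.
lra.
Qed.

(** * Differentiation with respect to the parameter *)

Lemma is_derive_littleo (R : realType) (V : normedModType R)
    (h : R -> V) (x0 : R) (a : V) :
  (forall e, 0 < e -> exists2 d, 0 < d &
    forall x, `|x| < d -> `|h (x + x0) - h x0 - x *: a| <= e * `|x|) ->
  is_derive x0 1 h a.
Proof.
move=> H.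
suff L : t^-1 *: (h (t *: 1 + x0) - h x0) @[t --> 0^'] --> a.
  by split; [apply/cvg_ex; exists a|exact/cvg_lim].
apply/cvgrPdist_le => e /H[d d0 {}H]; near=> t.
have t0 : t != 0 by near: t; exact: nbhs_dnbhs_neq.
rewrite distrC -(scalerK t0 a) -scalerBr normrZ normfV ler_pdivrMl ?normr_gt0 //.
rewrite [t *: 1](mulr1 t) mulrC; apply: H.
by near: t; exact: dnbhs0_lt.
Unshelve. all: by end_near. Qed.

Lemma is_derive_quadratic (R : realType) (V : normedModType R)
    (h : R -> V) (x0 : R) (a : V) (C d : R) :
  0 < d -> (forall x, `|x| <= d -> `|h (x + x0) - h x0 - x *: a| <= C * x ^+ 2) ->
  is_derive x0 1 h a.
Proof.
move=> d0 H; apply: is_derive_littleo => e e0.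
have C0 := normr_ge0 C.
exists (Num.min d (e / (`|C| + 1))) => [|x].
  by rewrite lt_min d0 divr_gt0 //; lra.
rewrite lt_min => /andP[/ltW/H{}H]; rewrite ltr_pdivlMr; last by lra.
move=> /ltW xe; apply: le_trans H _.
rewrite -(real_normK (num_real x)) expr2 mulrA ler_wpM2r //.
have := ler_norm C; have := normr_ge0 x; nra.
Qed.

Lemma cvg_quotient (R : realType) (h : R -> R) (a : R) :
  h 0 = 0 -> is_derive (0 : R) 1 h a -> l^-1 * h l @[l --> 0^'] --> a.
Proof.
move=> h0 [/cvg_ex[b hb]] <-.
have -> : 'D_1 h 0 = b by exact: cvg_lim hb.
apply: cvg_trans hb; apply: near_eq_cvg; near=> t.
by rewrite /= h0 subr0 addr0 [t *: 1](mulr1 t).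
Unshelve. all: by end_near. Qed.

(** Interchange of the derivatives in l and s: G is the limit of F l / l, whose s-derivative q l s
    is close to q 0 y jointly in (l, s). The mean value estimate is uniform in l and survives the
    limit l -> 0. *)
Lemma is_derive_param_derive (R : realType) (F q : R -> R -> R) (G : R -> R) (y r0 : R) :
  0 < r0 ->
  (forall l s : R, `|l| < r0 -> is_derive s 1 (F l) (l * q l s)) ->
  (forall s, F 0 s = 0) ->
  (forall s : R, is_derive (0 : R) 1 (F ^~ s) (G s)) ->
  (forall e, 0 < e -> exists2 r, 0 < r &
    forall l s : R, `|l| < r -> `|s - y| < r -> `|q l s - q 0 y| <= e) ->
  is_derive y 1 G (q 0 y).
Proof.
move=> r00 dF F0 FG qc; apply: is_derive_littleo => e /qc[r r_gt0 {}qc].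
exists r => // x xr.
have L : `|l^-1 * F l (x + y) - l^-1 * F l y - x * q 0 y| @[l --> 0^'] -->
    `|G (x + y) - G y - x * q 0 y|.
  apply: cvg_norm; apply: cvgB; last exact: cvg_cst.
  by apply: cvgB; exact: cvg_quotient.
apply: (cvgr_to_le L); near=> l.
have l0 : l != 0 by near: l; exact: nbhs_dnbhs_neq.
have lr : `|l| < r by near: l; exact: dnbhs0_lt.
have lr0 : `|l| < r0 by near: l; exact: dnbhs0_lt.
(* With the expected linear part subtracted, the derivative is l (q l s - q 0 y); the factor |l|
   then cancels on both sides. *)
have := @mvt_le _ (fun s => F l s - l * q 0 y * s)
  (fun s => l * (q l s - q 0 y)) y (x + y) (`|l| * e).
rewrite addrK => /(_ _ _).
have -> : F l (x + y) - l * q 0 y * (x + y) - (F l y - l * q 0 y * y)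
    = l * (l^-1 * F l (x + y) - l^-1 * F l y - x * q 0 y) by field.
rewrite normrM -mulrA ler_pM2l ?normr_gt0 //; apply => s sxy.
  have H := dF l s lr0; apply: is_derive_eq; rewrite /GRing.scale /=; ring.
rewrite normrM ler_wpM2l // qc //.
move: xr sxy; rewrite !ltr_norml.
by case: (leP y (x + y)) => ? /andP[? ?] /andP[? ?]; apply/andP; split; lra.
Unshelve. all: by end_near. Qed.

(** * Tail estimates, analytic families and decay of parameter derivatives *)

Lemma cvg_expRN (R : realType) (k : R) : 0 < k -> expR (- (k * s)) @[s --> +oo] --> 0.
Proof.
move=> k0; apply: (@cvg_comp _ _ _ (fun s => k * s) (fun s => expR (- s))).
  exact: gt0_cvgMry.
exact: cvgr_expR.
Qed.

(** The function F(t) - (B / k) e^{-kt} has nonnegative derivative on [s, +oo) and tends to 0, so it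
    is at most 0 at s. Applying this to -F as well gives the absolute value. *)
Lemma tail_bound (R : realType) (F dF : R -> R) (s B k : R) : 0 < k ->
  (forall t : R, is_derive t 1 F (dF t)) ->
  (forall t, s <= t -> `|dF t| <= B * expR (- (k * t))) ->
  F t @[t --> +oo] --> 0 ->
  `|F s| <= B / k * expR (- (k * s)).
Proof.
move=> k0; wlog suff: F dF / (forall t : R, is_derive t 1 F (dF t)) ->
  (forall t, s <= t -> `|dF t| <= B * expR (- (k * t))) ->
  F t @[t --> +oo] --> 0 ->
  F s <= B / k * expR (- (k * s)).
  move=> H dF1 dFB F0; rewrite ler_norml H // andbT lerNl.
  apply: (H (fun t => - F t) (fun t => - dF t)) => [t st|].
  - by rewrite normrN; exact: dFB.
  - by rewrite -oppr0; exact: cvgN.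
move=> dF1 dFB F0.
have L : B / k * expR (- (k * s)) + (F t - B / k * expR (- (k * t))) @[t --> +oo] -->
    B / k * expR (- (k * s)) + (0 - B / k * 0).
  apply: cvgD; first exact: cvg_cst.
  by apply: cvgB => //; apply: cvgMr; exact: cvg_expRN.
rewrite mulr0 subr0 addr0 in L.
apply: (cvgr_to_ge L); near=> t.
have st : s <= t by near: t; apply: nbhs_pinfty_ge; exact: num_real.
pose H x := F x - B / k * expR (- (k * x)).
have dH (x : R) : is_derive x 1 H (dF x + B * expR (- (k * x))).
  have h1 := dF1 x.
  rewrite /H; apply: is_derive_eq; rewrite /GRing.scale /=; field; lra.
have cH : {within `[s, t], continuous H}.
  by apply: derivable_within_continuous => x _; have [] := dH x.
have [x] := MVT_segment st (fun x _ => dH x) cH.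
rewrite in_itv /= => /andP[sx _] E.
have : 0 <= H t - H s.
  rewrite E mulr_ge0 ?subr_ge0 //.
  have := dFB _ sx; rewrite ler_norml => /andP[]; lra.
rewrite /H; lra.
Unshelve. all: by end_near. Qed.

(** Comparison with a geometric series bounds the remainder after the linear term by a multiple of
    x^2, so the derivative is the coefficient [a 1]. The point is interior to D, which makes the
    derivative two-sided. *)
Lemma analytic_derivable (R : realType) (V : normedModType R) (D : set R)
    (h : R -> V) (x0 : R) :
  analytic_on D h -> nbhs x0 D -> derivable h x0 1.
Proof.
move=> hD Dx0; have [r [a [r0 ha]]] := hD _ (nbhs_singleton Dx0).
have [d /= d0 Dd] := Dx0.
pose x1 := Num.min r d / 2.
have x10 : 0 < x1 by rewrite divr_gt0 // lt_min r0.
have [x1r x1d] : x1 < r /\ x1 < d.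
  have : x1 + x1 = Num.min r d by rewrite /x1; lra.
  have := ge_min r r d; have := ge_min d r d; rewrite !lexx orbT /= => ? ?.
  by split; lra.
have {}ha x : `|x| <= x1 -> series (fun k => x ^+ k *: a k) @ \oo --> h (x + x0).
  move=> xx1; have := ha (x + x0); rewrite addrK; apply; last exact: le_lt_trans x1r.
  by apply: Dd; rewrite /ball /= distrC addrK; exact: le_lt_trans x1d.
have x1x1 : `|x1| <= x1 by rewrite ger0_norm // ltW.
(* Convergence at [x1] forces the terms of the series there to be bounded. *)
have [M M0 aM] : exists2 M, 0 <= M & forall k, `|a k| <= M / x1 ^+ k.
  have /cvgP/cvg_series_cvg_0/cvgP/cvg_seq_bounded[M [_ MP]] := ha x1 x1x1.
  exists (`|M| + 1) => [|k]; first by rewrite addr_ge0.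
  have := MP (`|M| + 1) _ k I.
  rewrite /= normrZ ger0_norm; last by rewrite exprn_ge0 // ltW.
  rewrite ler_pdivlMr ?exprn_gt0 // mulrC; apply.
  have := ler_norm M; lra.
suff : is_derive x0 1 h (a 1%N) by case.
have E x : `|x| <= x1 / 2 -> `|h (x + x0) - a 0%N - x *: a 1%N| <= 2 * M * (x / x1) ^+ 2.
  move=> xx1.
  pose q := `|x| / x1.
  have q0 : 0 <= q by rewrite divr_ge0 // ltW.
  have q2 : q <= 1 / 2 by rewrite ler_pdivrMr //; lra.
  (* Since q <= 1/2, the terms from index 2 on are at most M q^2 2^{-j}; the last factor is the
     closed form of the finite geometric sum, which makes the induction go through. *)
  have P n : `|series (fun k => x ^+ k *: a k) n.+2 - a 0%N - x *: a 1%N|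
      <= 2 * M * q ^+ 2 * (1 - (1 / 2) ^+ n).
    elim: n => [|n IH].
      rewrite seriesEord /= !big_ord_recr big_ord0 /=.
rewrite add0r expr0 scale1r expr1.
      by rewrite addrAC addrK subrr normr0 expr0 subrr mulr0.
    rewrite seriesSr.
    have -> (s t b b' : V) : s + t - b - b' = (s - b - b') + t.
      by rewrite -!addrA; congr (_ + _); rewrite addrC -addrA.
    apply: le_trans (ler_normD _ _) _.
    have T : `|x ^+ n.+2 *: a n.+2| <= M * q ^+ 2 * (1 / 2) ^+ n.
      rewrite normrZ normrX; apply: (@le_trans _ _ (`|x| ^+ n.+2 * (M / x1 ^+ n.+2))).
        by rewrite ler_wpM2l // exprn_ge0.
      rewrite mulrCA -expr_div_n -/q -mulrA ler_wpM2l // -addn2 addnC exprD.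
      by rewrite ler_wpM2l ?exprn_ge0 // lerXn2r // nnegrE //; lra.
    apply: le_trans (lerD IH T) _; rewrite (exprS (1 / 2) n); lra.
  have -> : (x / x1) ^+ 2 = q ^+ 2.
    by rewrite !expr_div_n real_normK // num_real.
  have xle : `|x| <= x1 by lra.
  have L : `|series (fun k => x ^+ k *: a k) n.+2 - a 0%N - x *: a 1%N| @[n --> \oo]
     --> `|h (x + x0) - a 0%N - x *: a 1%N|.
    apply: cvg_norm; apply: cvgB; last exact: cvg_cst; apply: cvgB; last exact: cvg_cst.
    have := ha _ xle; rewrite -(cvg_shiftn 2); under eq_fun do rewrite addn2; exact.
  apply: (cvgr_to_le L); near=> n; apply: le_trans (P n) _.
  apply: ler_piMr; first by apply: mulr_ge0; [exact: mulr_ge0|exact: exprn_ge0].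
  have : 0 <= (1 / 2 : R) ^+ n by rewrite exprn_ge0 //; lra.
  lra.
have h0 : h x0 = a 0%N.
  have := E 0; rewrite normr0 mul0r expr0n mulr0 add0r scale0r subr0 => /(_ _).
  rewrite normr_le0 subr_eq0 => H; apply/eqP/H; lra.
apply: (@is_derive_quadratic _ _ _ _ _ (2 * M / x1 ^+ 2) (x1 / 2)) => [|x xx1].
  exact: divr_gt0.
rewrite h0; apply: le_trans (E _ xx1) _; rewrite expr_div_n; lra.
Unshelve. all: by end_near. Qed.
(** For fixed l, [tail_bound] with constant |l| C gives |F l s / l| <= (C / k) e^{-ks}. This is
    uniform in l, so it passes to the limit G s. *)
Lemma param_derive_decay (R : realType) (F q : R -> R -> R) (G : R -> R) (r C k : R) :
  0 < r -> 0 < k ->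
  (forall l s : R, `|l| < r -> is_derive s 1 (F l) (l * q l s)) ->
  (forall s, F 0 s = 0) ->
  (forall s : R, is_derive (0 : R) 1 (F ^~ s) (G s)) ->
  (\forall s \near +oo, forall l, `|l| < r -> `|q l s| <= C * expR (- (k * s))) ->
  (forall l, `|l| < r -> F l s @[s --> +oo] --> 0) ->
  G s @[s --> +oo] --> 0.
Proof.
move=> r0 k0 dF F0 FG [Z [_ qC]] Foo; apply/norm_cvg0P.
apply: (@squeeze_cvgr _ _ _ _ (fun=> 0) (fun s => C / k * expR (- (k * s)))).
- near=> s; rewrite normr_ge0 /=.
  have L : `|l^-1 * F l s| @[l --> 0^'] --> `|G s|.
    by apply: cvg_norm; exact: cvg_quotient.
  apply: (cvgr_to_le L); near=> l.
  have l0 : 0 < `|l| by rewrite normr_gt0; near: l; exact: nbhs_dnbhs_neq.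
  have lr : `|l| < r by near: l; exact: dnbhs0_lt.
  rewrite normrM normfV ler_pdivrMl // !mulrA.
  apply: (tail_bound k0 (fun t => dF l t lr)); last exact: Foo.
  move=> t st; rewrite normrM -mulrA ler_pM2l //; apply: qC => //.
  by apply: lt_le_trans st; near: s; apply: nbhs_pinfty_gt; exact: num_real.
- exact: cvg_cst.
- by rewrite -[X in _ --> X](mulr0 (C / k)); apply: cvgMr; exact: cvg_expRN.
Unshelve. all: by end_near. Qed.

(** Follows by the reflection s -> -s, which changes the sign of q. *)
Lemma param_derive_decayN (R : realType) (F q : R -> R -> R) (G : R -> R) (r C k : R) :
  0 < r -> 0 < k ->
  (forall l s : R, `|l| < r -> is_derive s 1 (F l) (l * q l s)) ->
  (forall s, F 0 s = 0) ->
  (forall s : R, is_derive (0 : R) 1 (F ^~ s) (G s)) ->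
  (\forall s \near -oo, forall l, `|l| < r -> `|q l s| <= C * expR (k * s)) ->
  (forall l, `|l| < r -> F l s @[s --> -oo] --> 0) ->
  G s @[s --> -oo] --> 0.
Proof.
move=> r0 k0 dF F0 FG qC Foo; apply/cvgNy_compNP.
apply: (@param_derive_decay _ (fun l s => F l (- s)) (fun l s => - q l (- s))
  (G \o -%R) r C k) => //.
- move=> l s lr; have := dF l (- s) lr => H.
  have := @is_derive1_comp _ (F l) -%R s _ _ H (is_deriveNid _ _).
  by rewrite mulrN1 mulrN.
- move: qC => [Z [_ qC]]; near=> s => l lr; rewrite normrN -mulrN; apply: qC => //.
  rewrite ltrNl; near: s.
apply: nbhs_pinfty_gt; exact: num_real.
- by move=> l lr; have /cvgNy_compNP := Foo l lr.
Unshelve. all: by end_near. Qed.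

(* [eta] is not assumed continuous: it is bounded near 0 because [eta] is
   uniformly close to [expR (- mu l * z0) *: u l z0] for one fixed [z0]. *)
Lemma asymptotic_solution_bound (R : realType) (D : set R) (F : set_system R)
    {FF : ProperFilter F}
    (A : R -> R -> 'M[R]_4) (Ainf : R -> 'M[R]_4) (mu : R -> R)
    (u : R -> R -> 'cV[R]_4) (eta : R -> 'cV[R]_4) (d : R) :
  0 < d -> (forall l, `|l| <= d -> D l) -> {for 0, continuous mu} ->
  asymptotic_solution D F A Ainf mu u eta ->
  exists r C, [/\ 0 < r, r <= d, 0 <= C &
    \forall z \near F, forall l, `|l| < r -> `|u l z| <= C * expR (mu l * z)].
Proof.
move=> d0 dD cmu [_ an _ un].
have KD : `[- d, d] `<=` D by move=> l /=; rewrite in_itv /= -ler_norml => /dD.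
have := un _ (@segment_compact _ (- d) d) KD.
move=> /(_ [set h | forall l, `[- d, d]%classic l -> ball (eta l) 1 (h l)]) /=.
rewrite nbhs_simpl /=.
have N : nbhs (eta : {uniform` `[-d, d]%classic -> 'cV[R]_4})
   [set h | forall l, `[- d, d]%classic l -> ball (eta l) 1 (h l)].
  apply/uniform_nbhs; exists [set xy | ball xy.1 1 xy.2]; split => //.
  exact: (entourage_ball _ 1%:pos).
move=> /(_ N){N un} near1.
have [z0 z0P] := filter_ex near1.
pose w l := expR (- mu l * z0) *: u l z0.
have cw : {for 0, continuous w}.
  apply: cvgZ; last first.
    apply/differentiable_continuous/derivable1_diffP/(analytic_derivable (an z0)).
    apply: filterS (nbhs0_le d0) => l; exact: dD.
  apply: (@continuous_comp _ _ _ (fun l => - mu l * z0) expR).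
    by apply: cvgMl; apply: cvgN.
  exact: continuous_expR.
have /(_ _ (`|w 0| + 1)) := cvgr_norm_lt _ (cw : w @ 0 --> w 0).
rewrite ltrDl ltr01 => /(_ isT)[e /= e0 we].
(* The 3 is made of two distances to [eta l], each below 1 (at z and at [z0]), and of the
   oscillation of [w] near 0, also below 1. *)
exists (Num.min e d), (`|w 0| + 3); split.
- by rewrite lt_min e0.
- by rewrite ge_min lexx orbT.
- by have := normr_ge0 (w 0); lra.
apply: filterS near1 => z zP l; rewrite lt_min => /andP[le ld].
have lK : l \in `[- d, d]%R by rewrite in_itv /= -ler_norml ltW.
have {}we : `|w l| < `|w 0| + 1 by apply: we; rewrite /ball_ /= sub0r normrN.
have := zP l lK; have := z0P l lK; rewrite -!ball_normE /= -/(w l) => h1 h2.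
have E : u l z = expR (mu l * z) *: (expR (- mu l * z) *: u l z).
  by rewrite scalerA -expRD mulNr subrr expR0 scale1r.
rewrite {1}E normrZ ger0_norm ?expR_ge0 // mulrC ler_wpM2r ?expR_ge0 //.
set v := expR _ *: _ in h2 *.
have : `|v| <= `|v - eta l| + `|eta l - w l| + `|w l|.
  rewrite -[X in `|X| <= _](subrK (w l)) (le_trans (ler_normD _ _)) // lerD2r.
  by rewrite -(subrKA (eta l)) ler_normD.
rewrite distrC; lra.
Qed.
(** * Integration of exponentially decaying functions *)

Lemma continuous_exp_abs (R : realType) (k : R) :
  continuous (fun x : R => expR (- (k * `|x|))).
Proof.
move=> x; apply: (@continuous_comp _ _ _ (fun x : R => - (k * `|x|)) expR).
  by apply: cvgN; apply: cvgMr; exact: norm_continuous.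
exact: continuous_expR.
Qed.

Lemma integral_exp_absE (R : realType) (k : R) : 0 < k ->
  (\int[@lebesgue_measure R]_x (expR (- (k * `|x|)))%:E = (2 / k)%:E)%E.
Proof.
move=> k0; have cg := @continuous_exp_abs R k.
have sg (x : R) : expR (- (k * `|x|)) = expR (- (k * `|- x|)) by rewrite normrN.
rewrite (ge0_symfun_integralT _ cg sg) => [|x]; last exact: expR_ge0.
rewrite -set_itvcy.
pose E (x : R) := - k^-1 * expR (- (k * x)).
have dE (x : R) : is_derive x 1 E (expR (- (k * x))).
  by rewrite /E; apply: is_derive_eq; rewrite /GRing.scale /=; field; lra.
rewrite (@ge0_continuous_FTC2y _ _ E 0 0).
- rewrite /E mulr0 oppr0 expR0 -EFinN add0e -EFinM; congr EFin; ring.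
- by move=> x _; exact: expR_ge0.
- exact: continuous_subspaceT.
- by rewrite -[X in _ --> X](mulr0 (- k^-1)); apply: cvgMr; exact: cvg_expRN.
- by move=> x _; have [] := dE x.
- apply: cvg_at_right_filter.
  apply: (@differentiable_continuous _ _ _ 0 E); apply/derivable1_diffP.
  by have [] := dE 0.
- move=> x; rewrite in_itv /= andbT => x0.
  by rewrite derive1E (@derive_val _ _ _ _ _ _ _ (dE x)) gtr0_norm.
Qed.

(** A global majorant K e^{-k|x|} gives integrability. The integral over [-n, n] is H(n) - H(-n);
    dominated convergence identifies its limit with the integral over the line. *)
Lemma integral_exp_decay (R : realType) (h H : R -> R) (C1 k1 C2 k2 a b : R) :
  0 < k1 -> 0 < k2 ->
  continuous h ->
  (forall x : R, is_derive x 1 H (h x)) ->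
  (\forall x \near +oo, `|h x| <= C1 * expR (- (k1 * x))) ->
  (\forall x \near -oo, `|h x| <= C2 * expR (k2 * x)) ->
  H x @[x --> +oo] --> a ->
  H x @[x --> -oo] --> b ->
  (@lebesgue_measure R).-integrable setT (EFin \o h) /\
  \int[@lebesgue_measure R]_x h x = a - b.
Proof.
move=> k10 k20 ch dH hp hm Ha Hb.
pose k := Num.min k1 k2.
have k0 : 0 < k by rewrite lt_min k10.
have mh : measurable_fun setT h by exact: continuous_measurable_fun.
have [K hK] : exists K, forall x, `|h x| <= K * expR (- (k * `|x|)).
  have [Z1 [_ {}hp]] := hp; have [Z2 [_ {}hm]] := hm.
  (* Beyond Z on either side the corresponding tail bound holds; on [-Z, Z] the maximum of |h| is
     used. *)
  pose Z := `|Z1| + `|Z2| + 1.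
  have Z0 : - Z <= Z by have := normr_ge0 Z1; have := normr_ge0 Z2; rewrite /Z; lra.
  have cn : {within `[- Z, Z], continuous (fun x => `|h x|)}.
    apply: continuous_subspaceT => x.
    by apply: continuous_comp; [exact: ch|exact: norm_continuous].
  have [x0 _ hx0] := EVT_max Z0 cn.
  (* The factor e^{kZ} compensates e^{-k|x|} on [-Z, Z]. Absolute values are taken since [C1] and
     [C2] have no prescribed sign. *)
  exists (`|C1| + `|C2| + `|h x0| * expR (k * Z)) => x.
  have e0 := expR_gt0 (- (k * `|x|)).
  have P0 : 0 <= `|h x0| * expR (k * Z) by rewrite mulr_ge0 // expR_ge0.
  have bnd C k' : k <= k' -> `|C| <= `|C1| + `|C2| ->
      `|h x| <= C * expR (- (k' * `|x|)) ->
      `|h x| <= (`|C1| + `|C2| + `|h x0| * expR (k * Z)) * expR (- (k * `|x|)).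
    move=> kk' CC /le_trans; apply; apply: (@le_trans _ _ (`|C| * expR (- (k' * `|x|)))).
      by rewrite ler_wpM2r ?expR_ge0 // ler_norm.
    apply: ler_pM => //.
      by apply: le_trans CC _; rewrite lerDl.
    by rewrite ler_expR lerN2 ler_wpM2r.
  have := ler_norm Z1; have := ler_norm (- Z2); rewrite normrN => Z2n Z1n.
  have [xZ|xZ] := ltP Z x.
    have Z1x : Z1 < x by move: xZ; rewrite /Z; have := normr_ge0 Z2; lra.
    have x_ge0 : 0 <= x by move: xZ Z0; lra.
    by apply: (bnd C1 k1); rewrite ?(ger0_norm x_ge0) ?ge_min ?lexx ?lerDl //; exact: hp.
  have [xZ'|xZ'] := ltP x (- Z).
    have Z1x : x < Z2 by move: xZ'; rewrite /Z; have := normr_ge0 Z1; lra.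
    have x_le0 : x <= 0 by move: xZ' Z0; lra.
    apply: (bnd C2 k2); rewrite ?ge_min ?lexx ?orbT ?lerDr //.
    by rewrite (ler0_norm x_le0) mulrN opprK; exact: hm.
  apply: (@le_trans _ _ (`|h x0| * expR (k * Z) * expR (- (k * `|x|)))); last first.
    by rewrite ler_pM2r // lerDr addr_ge0.
  have xI : x \in `[- Z, Z]%R by rewrite in_itv /= xZ' xZ.
  apply: le_trans (hx0 _ xI) _; rewrite -mulrA -expRD ler_peMr //.
  rewrite -expR0 ler_expR -mulrBr mulr_ge0 ?(ltW k0) // subr_ge0 ler_norml xZ'; exact: xZ.
pose g (x : R) := K * expR (- (k * `|x|)).
have mg : (@lebesgue_measure R).-integrable setT (EFin \o g).
  have -> : EFin \o g = (fun x => (K%:E * (expR (- (k * `|x|)))%:E)%E) by apply/funext.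
  apply: integrableZl => //.
  apply/integrableP; split.
    apply/measurable_EFinP; apply: continuous_measurable_fun.
    exact: continuous_exp_abs.
  under eq_integral do rewrite gee0_abs ?lee_fin ?expR_ge0 //.
  by rewrite integral_exp_absE // ltry.
have ih : (@lebesgue_measure R).-integrable setT (EFin \o h).
  apply: (le_integrable _ _ _ mg) => //; first exact/measurable_EFinP.
  by move=> x _; rewrite /= lee_fin; apply: le_trans (hK x) (ler_norm _).
split => //.
pose I (n : nat) : set R := `[- n%:R, n%:R]%classic.
have L1 : (\int[@lebesgue_measure R]_(x in I n) (h x)%:E)%E @[n --> \oo] -->
    (\int[@lebesgue_measure R]_x (h x)%:E)%E.
  under eq_fun do rewrite integral_mkcond.
  have mI n : measurable (I n) by exact: measurable_itv.
  have mEh : measurable_fun setT (EFin \o h) by exact/measurable_EFinP.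
  have mn n : measurable_fun setT ((EFin \o h) \_ (I n)).
    apply: (measurable_restrictT _ (mI n)).1.
    exact: (measurable_funS measurableT _ mEh).
  have aecvg : {ae @lebesgue_measure R, forall x, setT x ->
      ((EFin \o h) \_ (I n)) x @[n --> \oo] --> (EFin \o h) x}.
    apply: aeW => x _; apply: cvg_near_cst; near=> n.
    rewrite patchT // inE /I /= in_itv /= -ler_norml; near: n.
    exact: nbhs_infty_ger.
  have aele : {ae @lebesgue_measure R, forall x n, setT x ->
      (`|((EFin \o h) \_ (I n)) x| <= (EFin \o g) x)%E}.
    apply: aeW => x n _; rewrite patchE; case: ifP => _ /=; first by rewrite lee_fin.
    by rewrite normr0 lee_fin (le_trans _ (hK x)).
  by have [] := @dominated_convergence _ _ _ (@lebesgue_measure R) setT measurableT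
    (fun n => (EFin \o h) \_ (I n)) _ _ mn mEh aecvg mg aele.
have L2 : (H n%:R - H (- n%:R))%:E @[n --> \oo] --> (a - b)%:E.
  apply: cvg_EFin; first exact: nearW.
  apply: cvgB.
    by apply: (@cvg_comp _ _ _ (fun n : nat => n%:R) H); [exact: cvgr_idn|exact: Ha].
  apply: (@cvg_comp _ _ _ (fun n : nat => n%:R) (H \o -%R)); first exact: cvgr_idn.
  exact/cvgNy_compNP.
rewrite /Rintegral.
have -> : (\int[@lebesgue_measure R]_x (h x)%:E)%E = (a - b)%:E.
  apply: cvg_unique L1 _ => //; apply: cvg_trans L2; apply: near_eq_cvg; near=> n.
  rewrite /I.
  have n0 : 0 < n%:R :> R by rewrite ltr0n; near: n; exact: nbhs_infty_gt.
  have cH x : {for x, continuous H}.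
    by apply/differentiable_continuous/derivable1_diffP; have [] := dH x.
  rewrite (@continuous_FTC2 _ _ H) ?EFinB //.
  - lra.
  - exact: continuous_subspaceT.
  - split => [x _| |]; first by have [] := dH x.
      by apply: cvg_at_right_filter; exact: cH.
    by apply: cvg_at_left_filter; exact: cH.
  - by move=> x _; rewrite derive1E (@derive_val _ _ _ _ _ _ _ (dH x)).
by [].
Unshelve. all: by end_near. Qed.
(** * The linearized system *)

Lemma norm_lin3_le (R : realType) (a b d x y w N : R) :
  `|x| <= N -> `|y| <= N -> `|w| <= N ->
  `|a * x + b * y + d * w| <= (`|a| + `|b| + `|d|) * N.
Proof.
move=> xN yN wN; rewrite !mulrDl.
apply: le_trans (ler_normD _ _) _; apply: lerD; last by rewrite normrM ler_wpM2l.
by apply: le_trans (ler_normD _ _) _; apply: lerD; rewrite normrM ler_wpM2l.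
Qed.

Lemma A_mx_locally_bounded (R : realType) (f g : R -> R) (alpha sigma c : R)
    (uh vh : R -> R) (y : R) :
  {for y, continuous (derive1 f \o uh)} -> {for y, continuous (derive1 g \o vh)} ->
  exists K r : R, [/\ 0 <= K, 0 < r &
    forall l s (v : 'cV[R]_4), `|l| < r -> `|s - y| < r ->
    `|A_mx f g alpha sigma c uh vh l s *m v| <= K * `|v|].
Proof.
move=> cf cg.
have near_bound (p : R -> R) : {for y, continuous p} -> exists2 r, 0 < r &
    forall s, `|s - y| < r -> `|p s| <= `|p y| + 1.
  move=> cp; have /(_ _ (`|p y| + 1)) := cvgr_norm_le _ (cp : p @ y --> p y).
  rewrite ltrDl ltr01 => /(_ isT)[r /= r0 H]; exists r => // s sr.
  by apply: H; rewrite /= distrC.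
have [rf rf0 fb] := near_bound _ cf; have [rg rg0 gb] := near_bound _ cg.
pose F := `|derive1 f (uh y)| + 1; pose G := `|derive1 g (vh y)| + 1.
(* The sum of the absolute row sums of A, bounded for |l| < 1 and s near y. *)
pose K := `|sigma| + `|alpha| + ((1 + F) / `|sigma| + 1 + `|c|)
  + (1 + (1 + G) / `|alpha| + `|c|).
have F0 : 0 <= F by rewrite addr_ge0.
have G0 : 0 <= G by rewrite addr_ge0.
have s0 : 0 <= (1 + F) / `|sigma| by rewrite divr_ge0 // addr_ge0.
have a0 : 0 <= (1 + G) / `|alpha| by rewrite divr_ge0 // addr_ge0.
have [[n1 n2] n3] := (normr_ge0 sigma, normr_ge0 alpha, normr_ge0 c).
have K0 : 0 <= K by rewrite /K; lra.
exists K, (Num.min 1 (Num.min rf rg)); split => //; first by rewrite !lt_min ltr01 rf0.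
move=> l s v; rewrite !lt_min => /andP[l1 _] /and3P[_ /fb/= fs /gb/= gs].
have vle i : `|v i 0| <= `|v| := norm_coord_le _ _ _.
have B1 : `|(l - derive1 f (uh s)) / sigma| <= (1 + F) / `|sigma|.
  rewrite normrM normfV ler_wpM2r ?invr_ge0 //.
  apply: le_trans (ler_normB _ _) _; apply: lerD => //; exact: ltW.
have B2 : `|(l - derive1 g (vh s)) / alpha| <= (1 + G) / `|alpha|.
  rewrite normrM normfV ler_wpM2r ?invr_ge0 //.
  apply: le_trans (ler_normB _ _) _; apply: lerD => //; exact: ltW.
apply: le_norm_coord => [|i j]; first by rewrite mulr_ge0.
have n1' : `|1 : R| = 1 := normr1 _.
rewrite (ord1 j) A_mx_mulE mxE; elim/forall_ord4: i => /=.
- by rewrite normrM ler_pM // /K; lra.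
- by rewrite normrM ler_pM // /K; lra.
- rewrite -[v 1 0]mul1r -mulNr.
  apply: le_trans (norm_lin3_le _ _ _ (vle _) (vle _) (vle _)) _.
  by rewrite ler_wpM2r // normr1 normrN /K; lra.
- rewrite -mulN1r -mulNr.
  apply: le_trans (norm_lin3_le _ _ _ (vle _) (vle _) (vle _)) _.
  by rewrite ler_wpM2r // normrN normr1 normrN /K; lra.
Qed.

(** Joint continuity from continuity in the parameter at the single point y: moving from y to s
    costs at most |s - y| times a bound on A u, and [short_time_bound] makes that bound uniform in
    l. *)
Lemma solution_family_continuous (R : realType) (n : nat)
    (A : R -> R -> 'M[R]_n) (u : R -> R -> 'cV[R]_n) (y d : R) :
  0 < d ->
  (exists K r : R, [/\ 0 <= K, 0 < r &
    forall l s (v : 'cV[R]_n), `|l| < r -> `|s - y| < r ->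
    `|A l s *m v| <= K * `|v|]) ->
  (forall l s : R, `|l| < d -> is_derive s 1 (u l) (A l s *m u l s)) ->
  {for 0, continuous (u ^~ y)} ->
  {for (0, y), continuous (fun x : R * R => u x.1 x.2)}.
Proof.
move=> d0 [K [r1 [K0 r10 AK]]] du cu.
apply/cvgrPdist_le => e e0.
have e20 : 0 < e / 2 by rewrite divr_gt0.
have [r2 /= r20 ur2] : \forall l \near 0, `|u 0 y - u l y| <= e / 2.
  by have /cvgrPdist_le := cu; apply.
pose B := `|u 0 y| + e / 2.
have B0 : 0 <= B by rewrite addr_ge0 // ltW.
have KB0 : 0 <= K * B by rewrite mulr_ge0.
(* The last two entries ensure K r <= 1/2, for [short_time_bound], and 2 K B r <= e/2, for the
   displacement in s. Halving makes the other inequalities strict. *)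
pose r := Num.min (Num.min d r1)
  (Num.min r2 (Num.min (1 / (2 * (K + 1))) (e / (4 * (K * B + 1))))) / 2.
have : [/\ 0 < r, r < d, r < r1, r < r2 &
    r <= 1 / (2 * (K + 1)) /\ r <= e / (4 * (K * B + 1))].
  rewrite /r; set m := Num.min _ _.
  have m0 : 0 < m by rewrite !lt_min d0 r10 r20 !divr_gt0 //; lra.
  have : m <= m := lexx _; rewrite {2}/m !le_min => /andP[/andP[m1 m2] /and3P[m3 m4 m5]].
  split; try lra; split; lra.
move=> [r0 rd rr1 rr2 [rK re]].
have Kr : K * r <= 1 / 2.
  move: rK; rewrite ler_pdivlMr; last by lra.
  lra.
have Kre : K * (2 * B) * r <= e / 2.
  move: re; rewrite ler_pdivlMr; last by lra.
  lra.
exists (ball 0 r, ball y r); first by split; exact: nbhsx_ballx.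
move=> [l s] /= []; rewrite /ball /= sub0r normrN => lr sr.
have ld := lt_trans lr rd.
have sy (x : R) : `|x - y| <= r -> `|x - y| < r1 by move=> /le_lt_trans; apply.
have bnd := short_time_bound r0 K0 Kr (fun x _ => du l x ld)
   (fun x xr => AK _ _ _ (lt_trans lr rr1) (sy _ xr)).
have uly : `|u 0 y - u l y| <= e / 2.
  by apply: ur2; rewrite /ball_ /= sub0r normrN; exact: lt_trans rr2.
have ulB : `|u l y| <= B.
  rewrite -(subrK (u 0 y) (u l y)); apply: le_trans (ler_normD _ _) _.
  by rewrite /B addrC lerD2l distrC.
have sr' : `|s - y| <= r by rewrite distrC ltW.
have KB : 0 <= K * (2 * B) by rewrite mulr_ge0 // mulr_ge0.
have sub x : Num.min y s <= x <= Num.max y s -> `|x - y| <= r.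
  move: sr'; rewrite !ler_norml.
  by case: (leP y s) => ? /andP[? ?] /andP[? ?]; apply/andP; split; lra.
have := @mvt_mx_le _ _ _ (u l) (fun x => A l x *m u l x) y s _ KB (fun x _ => du l x ld).
have dB x : Num.min y s <= x <= Num.max y s -> `|A l x *m u l x| <= K * (2 * B).
  move=> /sub xr; apply: le_trans (AK _ _ _ (lt_trans lr rr1) (sy _ xr)) _.
  rewrite ler_wpM2l //; apply: le_trans (bnd _ xr) _; lra.
move=> /(_ dB) M.
rewrite -(subrKA (u l y)); apply: le_trans (ler_normD _ _) _.
rewrite (splitr e) lerD // distrC; apply: le_trans M _; apply: le_trans Kre.
by rewrite ler_wpM2l.
Qed.
Lemma continuous2_ball (R : realType) (q : R * R -> R) (y : R) :
  {for (0, y), continuous q} -> forall e, 0 < e -> exists2 r, 0 < r &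
    forall l s : R, `|l| < r -> `|s - y| < r -> `|q (l, s) - q (0, y)| <= e.
Proof.
move=> /cvgrPdist_le cq e /cq/nbhs_ballP[r /= r0 rP]; exists r => // l s lr sr.
rewrite distrC; apply: rP; split => /=; rewrite /ball /= ?sub0r ?normrN //.
by rewrite distrC.
Qed.

Lemma continuous_sqrt_discriminant (R : realType) (c nu : R) :
  continuous (fun l => Num.sqrt (c ^+ 2 + 4 * (l - nu))).
Proof.
move=> l; apply: (@continuous_comp _ _ _ (fun l => c ^+ 2 + 4 * (l - nu))).
  apply: cvgD; first exact: cvg_cst.
  by apply: cvgMr; apply: cvgB; [exact: cvg_id|exact: cvg_cst].
exact: sqrt_continuous.
Qed.

Lemma continuous_mu_minus (R : realType) (c nu : R) : continuous (mu_minus c nu).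
Proof.
move=> l; rewrite /mu_minus; apply: cvgB; first exact: cvg_cst.
by apply: cvgMl; exact: continuous_sqrt_discriminant.
Qed.

Lemma continuous_mu_plus (R : realType) (c nu : R) : continuous (mu_plus c nu).
Proof.
move=> l; rewrite /mu_plus; apply: cvgD; first exact: cvg_cst.
by apply: cvgMl; exact: continuous_sqrt_discriminant.
Qed.

(** * Exponential bounds for products of two solutions *)

Lemma Omega_le (R : realType) (c : R) (a b : R -> 'cV[R]_4) z B :
  expR (c * z) * (`|a z| * `|b z|) <= B -> `|Omega c a b z| <= 4 * B.
Proof.
move=> H; rewrite /Omega normrM (ger0_norm (expR_ge0 _)).
apply: (@le_trans _ _ (expR (c * z) * (4 * (`|a z| * `|b z|)))); last by lra.
by rewrite ler_wpM2l ?expR_ge0 ?omega_le.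
Qed.

Lemma Omega_density_le (R : realType) (sigma alpha c : R) (a b : R -> 'cV[R]_4) z B : 
  expR (c * z) * (`|a z| * `|b z|) <= B ->
  `|Omega_density sigma alpha c a b z| <= (`|sigma|^-1 + `|alpha|^-1) * B.
Proof.
move=> H; rewrite /Omega_density normrM (ger0_norm (expR_ge0 _)).
have P i j (k : R) : `|a z i 0 * b z j 0 / k| <= `|k|^-1 * (`|a z| * `|b z|).
  by rewrite normrM normfV mulrC ler_wpM2l ?invr_ge0 // normrM ler_pM // norm_coord_le.
apply: (@le_trans _ _ (expR (c * z) * ((`|sigma|^-1 + `|alpha|^-1) * (`|a z| * `|b z|)))).
  rewrite ler_wpM2l ?expR_ge0 // mulrDl; apply: le_trans (ler_normB _ _) _.
  by apply: lerD; exact: P.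
by rewrite mulrCA ler_wpM2l // addr_ge0 // invr_ge0.
Qed.

(** The three exponents add up to (c + mu l + nu 0) z. The majorant E of this sum is left free so
    that both ends of the line are covered. *)
Lemma asymptotic_product_bound (R : realType) (D : set R) (F : set_system R)
    {FF : ProperFilter F}
    (A : R -> R -> 'M[R]_4) (Ainf Binf : R -> 'M[R]_4) (mu nu : R -> R)
    (u v : R -> R -> 'cV[R]_4) (eta zeta : R -> 'cV[R]_4) (d c : R) (E : R -> R) :
  0 < d -> (forall l, `|l| <= d -> D l) ->
  {for 0, continuous mu} -> {for 0, continuous nu} ->
  asymptotic_solution D F A Ainf mu u eta ->
  asymptotic_solution D F A Binf nu v zeta ->
  (\forall z \near F, forall l, `|l| <= d -> (c + mu l + nu 0) * z <= E z) ->
  exists r C, [/\ 0 < r, r <= d &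
    \forall z \near F, forall l, `|l| < r ->
      expR (c * z) * (`|u l z| * `|v 0 z|) <= C * expR (E z)].
Proof.
move=> d0 dD cmu cnu hu hv hE.
have [r [C [r0 rd C0 uC]]] := asymptotic_solution_bound d0 dD cmu hu.
have [r' [C' [r'0 _ C'0 vC]]] := asymptotic_solution_bound d0 dD cnu hv.
exists r, (C * C'); split => //; near=> z => l lr.
have zE : (c + mu l + nu 0) * z <= E z.
  have ld : `|l| <= d by apply: le_trans rd; exact: ltW.
  by move: l ld {lr}; near: z; exact: hE.
have uz : `|u l z| <= C * expR (mu l * z) by move: l lr {zE}; near: z; exact: uC.
have vz : `|v 0 z| <= C' * expR (nu 0 * z).
  have : `|0 : R| < r' by rewrite normr0.
  by move: (0 : R); near: z; exact: vC.
apply: (@le_trans _ _ (expR (c * z) * ((C * expR (mu l * z)) * (C' * expR (nu 0 * z))))).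
  by rewrite ler_wpM2l ?expR_ge0 // ler_pM.
have -> : expR (c * z) * ((C * expR (mu l * z)) * (C' * expR (nu 0 * z))) =
   C * C' * expR ((c + mu l + nu 0) * z) by rewrite !mulrDl !expRD; ring.
by rewrite ler_wpM2l ?mulr_ge0 // ler_expR.
Unshelve. all: by end_near. Qed.
(** The two terms -c/2 cancel the weight c, leaving minus half the sum of two square roots. Dropping
    the one that depends on l gives a rate k uniform in l. *)
Lemma product_decay_minus (R : realType) (D : set R)
    (A : R -> R -> 'M[R]_4) (Ainf : R -> 'M[R]_4)
    (u v : R -> R -> 'cV[R]_4) (eta zeta : R -> 'cV[R]_4) (d c nu nu' : R) :
  0 < d -> (forall l, `|l| <= d -> D l) -> 0 < c ^+ 2 - 4 * nu' ->
  asymptotic_solution D +oo%R A Ainf (mu_minus c nu) u eta ->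
  asymptotic_solution D +oo%R A Ainf (mu_minus c nu') v zeta ->
  exists r C k, [/\ 0 < r, r <= d, 0 < k &
    \forall z \near +oo%R, forall l, `|l| < r ->
      expR (c * z) * (`|u l z| * `|v 0 z|) <= C * expR (- (k * z))].
Proof.
move=> d0 dD cnu hu hv; pose k := Num.sqrt (c ^+ 2 - 4 * nu') / 2.
have [|r [C [r0 rd H]]] := asymptotic_product_bound
    (c := c) (E := fun z => - (k * z)) d0 dD
    (@continuous_mu_minus _ c nu 0) (@continuous_mu_minus _ c nu' 0) hu hv.
  near=> z => l _; have z0 : 0 <= z by near: z; exact: nbhs_pinfty_ge.
  rewrite -mulNr ler_wpM2r // /mu_minus /k sub0r mulrN.
  have := sqrtr_ge0 (c ^+ 2 + 4 * (l - nu)); lra.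
by exists r, C, k; split => //; rewrite divr_gt0 // sqrtr_gt0.
Unshelve. all: by end_near. Qed.

Lemma product_decay_plus (R : realType) (D : set R)
    (A : R -> R -> 'M[R]_4) (Ainf : R -> 'M[R]_4)
    (u v : R -> R -> 'cV[R]_4) (eta zeta : R -> 'cV[R]_4) (d c nu nu' : R) :
  0 < d -> (forall l, `|l| <= d -> D l) -> 0 < c ^+ 2 - 4 * nu' ->
  asymptotic_solution D -oo%R A Ainf (mu_plus c nu) u eta ->
  asymptotic_solution D -oo%R A Ainf (mu_plus c nu') v zeta ->
  exists r C k, [/\ 0 < r, r <= d, 0 < k &
    \forall z \near -oo%R, forall l, `|l| < r ->
      expR (c * z) * (`|u l z| * `|v 0 z|) <= C * expR (k * z)].
Proof.
move=> d0 dD cnu hu hv; pose k := Num.sqrt (c ^+ 2 - 4 * nu') / 2.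
have [|r [C [r0 rd H]]] := asymptotic_product_bound
    (c := c) (E := fun z => k * z) d0 dD
    (@continuous_mu_plus _ c nu 0) (@continuous_mu_plus _ c nu' 0) hu hv.
  near=> z => l _; have z0 : z <= 0 by near: z; exact: nbhs_ninfty_le.
  rewrite ler_wnM2r // /mu_plus /k sub0r mulrN.
  have := sqrtr_ge0 (c ^+ 2 + 4 * (l - nu)); lra.
by exists r, C, k; split => //; rewrite divr_gt0 // sqrtr_gt0.
Unshelve. all: by end_near. Qed.

Lemma cvg_expR_Ny (R : realType) (k : R) : 0 < k -> expR (k * s) @[s --> -oo] --> 0.
Proof.
move=> k0; apply/cvgNy_compNP; have := cvg_expRN k0.
by under eq_fun do rewrite -mulrN.
Qed.

Lemma Omega_cvg0 (R : realType) (F : set_system R) {FF : Filter F} (c C : R) (e : R -> R)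
    (a b : R -> 'cV[R]_4) :
  (\forall z \near F, expR (c * z) * (`|a z| * `|b z|) <= C * e z) ->
  e @ F --> 0 -> Omega c a b @ F --> 0.
Proof.
move=> H e0; apply/norm_cvg0P.
apply: (@squeeze_cvgr _ _ _ _ (fun=> 0) (fun z => 4 * (C * e z))).
- by apply: filterS H => z /Omega_le ->; rewrite normr_ge0.
- exact: cvg_cst.
- rewrite -[X in _ --> X](mulr0 4) -(mulr0 C).
  by do 2 apply: cvgMr.
Qed.

(** Applies [is_derive_param_derive] to F l = Omega(u(l), u(0)). The spectral parameters are l and
    0, so their difference -l produces the minus sign before the density. *)
Lemma is_derive_param_Omega (R : realType) (f g : R -> R) (alpha sigma c : R)
    (uh vh : R -> R) (u : R -> R -> 'cV[R]_4) (G : R -> R) (d : R) :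
  0 < d ->
  (forall y, {for y, continuous (derive1 f \o uh)}) ->
  (forall y, {for y, continuous (derive1 g \o vh)}) ->
  (forall l s : R, `|l| < d ->
    is_derive s 1 (u l) (A_mx f g alpha sigma c uh vh l s *m u l s)) ->
  (forall y, {for 0, continuous (u ^~ y)}) ->
  (forall s : R, is_derive (0 : R) 1 (fun l => Omega c (u l) (u 0) s) (G s)) ->
  [/\ forall l s : R, `|l| < d -> is_derive s 1 (Omega c (u l) (u 0))
         (l * - Omega_density sigma alpha c (u l) (u 0) s),
     forall s, Omega c (u 0) (u 0) s = 0 &
     forall y : R, is_derive y 1 G (- Omega_density sigma alpha c (u 0) (u 0) y)].
Proof.
move=> d0 cf cg du cu dG.
have dF (l s : R) : `|l| < d -> is_derive s 1 (Omega c (u l) (u 0))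
         (l * - Omega_density sigma alpha c (u l) (u 0) s).
  move=> ld; have d00 : `|0 : R| < d by rewrite normr0.
  have := is_derive_Omega_solutions (du _ s ld) (du _ s d00).
  by rewrite sub0r mulNr mulrN.
have F0 s : Omega c (u 0) (u 0) s = 0 by rewrite /Omega /omega; ring.
split => // y.
apply: (@is_derive_param_derive _ (fun l s => Omega c (u l) (u 0) s)
   (fun l s => - Omega_density sigma alpha c (u l) (u 0) s) G y d d0 dF F0 dG).
have cuy := solution_family_continuous d0
  (A_mx_locally_bounded alpha sigma c (cf y) (cg y)) du (cu y).
have cu0 : {for (0, y), continuous (fun x : R * R => u 0 x.2)}.
  apply: (@continuous_comp _ _ _ snd (u 0)); first exact: cvg_snd.
  apply/differentiable_continuous/derivable1_diffP.
  have d00 : `|0 : R| < d by rewrite normr0.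
  by have [] := du 0 y d00.
have cX (w : R * R -> 'cV[R]_4) i : {for (0, y), continuous w} ->
    {for (0, y), continuous (fun x => w x i 0)}.
  move=> cw; apply: (@continuous_comp _ _ _ w (fun M : 'cV[R]_4 => M i 0)) => //.
  exact: coord_continuous.
apply: (@continuous2_ball _ (fun x => - Omega_density sigma alpha c (u x.1) (u 0) x.2)).
apply: cvgN; apply: cvgM.
  apply: (@continuous_comp _ _ _ (fun x : R * R => c * x.2) expR).
    by apply: cvgMr; exact: cvg_snd.
  exact: continuous_expR.
by apply: cvgB; apply: cvgMl; apply: cvgM; apply: cX.
Qed.

(** * Assembling the derivative of the Evans function *)

Lemma travelling_wave_continuous (R : realType) (f g : R -> R) (alpha sigma c : R)
    (uh vh : R -> R) :
  travelling_wave f g alpha sigma c uh vh -> continuous uh /\ continuous vh.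
Proof.
move=> [[hu [hv _]] _ _ _].
have E (w : R -> R) : (fun x => w (x - c * 0)) = w.
  by apply/funext => x; rewrite mulr0 subr0.
split=> x; apply/differentiable_continuous/derivable1_diffP.
  by have [_ + _] := hu x 0; rewrite E.
by have [_ + _] := hv x 0; rewrite E.
Qed.

Lemma C2_continuous_derive1 (R : realType) (f : R -> R) : C2 f -> continuous (derive1 f).
Proof. by move=> [_ df _] x; exact/differentiable_continuous/derivable1_diffP. Qed.

Lemma Omega_solutions_cst (R : realType) (f g : R -> R) (alpha sigma c : R)
    (uh vh : R -> R) (a b : R -> 'cV[R]_4) :
  (forall z : R, is_derive z 1 a (A_mx f g alpha sigma c uh vh 0 z *m a z)) ->
  (forall z : R, is_derive z 1 b (A_mx f g alpha sigma c uh vh 0 z *m b z)) ->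
  forall z z', Omega c a b z = Omega c a b z'.
Proof.
move=> da db z z'; apply: is_derive_0_is_cst => x.
by have := is_derive_Omega_solutions (da x) (db x); rewrite subrr mul0r.
Qed.

Lemma cst_cvg_eq0 (R : realType) (F : set_system R) {FF : ProperFilter F} (h : R -> R) :
  (forall z z', h z = h z') -> h @ F --> 0 -> forall z, h z = 0.
Proof.
move=> hc h0 z; have E : h = cst (h z) by apply/funext => x; exact: hc.
by move: h0; rewrite {1}E => /(cvg_unique (@norm_hausdorff _ _) (cvg_cst _)).
Qed.

(** Both factors of each of the first two products vanish at t, so these products have zero
    derivative; in the third only [w23] vanishes, and only its derivative contributes. *)
Lemma is_derive_pfaffian (R : realType) (k t : R) (w12 w34 w13 w24 w14 w23 : R -> R)
    (d12 d34 d13 d24 d14 d23 : R) :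
  is_derive t 1 w12 d12 -> is_derive t 1 w34 d34 -> is_derive t 1 w13 d13 ->
  is_derive t 1 w24 d24 -> is_derive t 1 w14 d14 -> is_derive t 1 w23 d23 ->
  w12 t = 0 -> w34 t = 0 -> w13 t = 0 -> w24 t = 0 -> w23 t = 0 ->
  is_derive t 1 (fun l => k * (w12 l * w34 l - w13 l * w24 l + w14 l * w23 l))
    (k * (w14 t * d23)).
Proof.
move=> h12 h34 h13 h24 h14 h23 e12 e34 e13 e24 e23.
apply: is_derive_eq; rewrite /GRing.scale /= e12 e34 e13 e24 e23; ring.
Qed.

Unset Implicit Arguments.

Theorem lemma3 (R : realType) (f g : R -> R) (alpha sigma c nu1 nu2 : R)
  (uh vh : R -> R)
  (hf : C2 f) (hg : C2 g) (halpha : 0 < alpha) (hsigma : 0 < sigma)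
  (hf0 : f 0 = 0) (hg0 : g 0 = 0)
  (htr : derive1 f 0 + derive1 g 0 < 0)
  (hdet : 0 < derive1 f 0 * derive1 g 0 + sigma * alpha)
  (hwave : travelling_wave f g alpha sigma c uh vh)
  (A1 : c < 0)
  (A2 : [/\ eigenvalue (lin0 f g alpha sigma) nu1,
            eigenvalue (lin0 f g alpha sigma) nu2,
            nu1 < nu2 & nu2 < 0])
  (A3p : ln `|phi alpha sigma uh vh z| / z @[z --> +oo%R]
           --> mu_minus c nu2 0)
  (A3m : ln `|phi alpha sigma uh vh z| / z @[z --> -oo%R]
           --> mu_plus c nu2 0)
  (A4 : transversely_constructed f g alpha sigma c uh vh)
  (Ainf : R -> 'M[R]_4)
  (hAp : forall lam : R,
     A_mx f g alpha sigma c uh vh lam z @[z --> +oo%R] --> Ainf lam)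
  (hAm : forall lam : R,
     A_mx f g alpha sigma c uh vh lam z @[z --> -oo%R] --> Ainf lam)
  (delta : R) (hdelta : 0 < delta)
  (hI : forall lam : R, - delta <= lam ->
     nu2 < lam /\
     [/\ mu_minus c nu1 lam < mu_minus c nu2 lam, mu_minus c nu2 lam < 0,
         0 < mu_plus c nu2 lam & mu_plus c nu2 lam < mu_plus c nu1 lam])
  (u1 u2 u3 u4 : R -> R -> 'cV[R]_4) (eta1 eta2 eta3 eta4 : R -> 'cV[R]_4)
  (hu1 : asymptotic_solution [set lam | - delta <= lam] +oo%R
     (A_mx f g alpha sigma c uh vh) Ainf (mu_minus c nu1) u1 eta1)
  (hu2 : asymptotic_solution [set lam | - delta <= lam] +oo%R
     (A_mx f g alpha sigma c uh vh) Ainf (mu_minus c nu2) u2 eta2)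
  (hu3 : asymptotic_solution [set lam | - delta <= lam] -oo%R
     (A_mx f g alpha sigma c uh vh) Ainf (mu_plus c nu2) u3 eta3)
  (hu4 : asymptotic_solution [set lam | - delta <= lam] -oo%R
     (A_mx f g alpha sigma c uh vh) Ainf (mu_plus c nu1) u4 eta4)
  (hnorm2 : forall z, u2 0 z = dphi alpha sigma uh vh z)
  (hnorm3 : forall z, u3 0 z = dphi alpha sigma uh vh z)
  (rho : R) (hrho : 0 < rho)
  (heta : det4 (eta1 0) (eta2 0) (eta3 0) (eta4 0) = rho) :
  let h := fun z : R =>
    expR (c * z) * ((derive1 uh z) ^+ 2 / sigma - (derive1 vh z) ^+ 2 / alpha) in
  (@lebesgue_measure R).-integrable setT (EFin \o h) /\
  forall z z' : R,
    is_derive (0 : R) 1 (evans c u1 u2 u3 u4 z)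
      (Omega c (u1 0) (u4 0) z' * (\int[@lebesgue_measure R]_s h s)).
Proof.
move=> h.
pose D := [set lam : R | - delta <= lam].
have dD l : `|l| <= delta -> D l by rewrite ler_norml => /andP[].
have D0 : nbhs 0 D by apply: filterS (nbhs0_le hdelta) => l; exact: dD.
have [_ _ _ nu20] := A2.
(* This discriminant is what makes all decay rates below positive. *)
have disc2 : 0 < c ^+ 2 - 4 * nu2 by have := sqr_ge0 c; lra.
have [cuh cvh] := travelling_wave_continuous hwave.
have cf y : {for y, continuous (derive1 f \o uh)}.
  by apply: continuous_comp; [exact: cuh|exact: C2_continuous_derive1].
have cg y : {for y, continuous (derive1 g \o vh)}.
  by apply: continuous_comp; [exact: cvh|exact: C2_continuous_derive1].
have family F mu u eta :
    asymptotic_solution D F (A_mx f g alpha sigma c uh vh) Ainf mu u eta ->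
    [/\ forall l s : R, `|l| < delta ->
          is_derive s 1 (u l) (A_mx f g alpha sigma c uh vh l s *m u l s),
        forall z : R, is_derive z 1 (u 0) (A_mx f g alpha sigma c uh vh 0 z *m u 0 z),
        forall z : R, derivable (u ^~ z) 0 1
      & forall z, {for 0, continuous (u ^~ z)}].
  move=> [du an _ _].
  have dz z : derivable (u ^~ z) 0 1 by exact: analytic_derivable (an z) D0.
  split=> [l s ld|z|//|z].
  - by apply: du; apply: dD; exact: ltW.
  - by apply: du; apply: dD; rewrite normr0 ltW.
  - exact/differentiable_continuous/derivable1_diffP.
have [du1 du1z pu1 cu1] := family _ _ _ _ hu1.
have [du2 du2z pu2 cu2] := family _ _ _ _ hu2.
have [du3 du3z pu3 cu3] := family _ _ _ _ hu3.
have [du4 du4z pu4 cu4] := family _ _ _ _ hu4.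
have u23 : u2 0 = u3 0 by apply/funext => z; rewrite hnorm2 hnorm3.
pose psi (u : R -> R -> 'cV[R]_4) z := 'D_1 (u ^~ z) (0 : R).
have dpsi (u : R -> R -> 'cV[R]_4) z :
    derivable (u ^~ z) 0 1 -> is_derive (0 : R) 1 (u ^~ z) (psi u z).
  by move=> ?; exact/derivableP.
(* For u = u2 or u3 the second argument is phi', so these are G2 and G3. *)
pose G (u : R -> R -> 'cV[R]_4) z := expR (c * z) * omega (psi u z) (u 0 z).
have dG (u : R -> R -> 'cV[R]_4) : (forall z : R, derivable (u ^~ z) 0 1) -> forall s : R,
    is_derive (0 : R) 1 (fun l => Omega c (u l) (u 0) s) (G u s).
  move=> pu s; have cst_u : is_derive (0 : R) 1 (fun=> u 0 s) 0 by exact: is_derive_cst.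
  have H := is_derive_omega (dpsi u s (pu s)) cst_u.
  rewrite /Omega /G; apply: is_derive_eq.
  rewrite /GRing.scale /= /omega !mxE; ring.
have [dF2 F02 dG2] := is_derive_param_Omega hdelta cf cg du2 cu2 (dG _ pu2).
have [dF3 F03 dG3] := is_derive_param_Omega hdelta cf cg du3 cu3 (dG _ pu3).
have hE z : h z = Omega_density sigma alpha c (u2 0) (u2 0) z.
  by rewrite /h /Omega_density hnorm2 !mxE /= !expr2.
have [r2 [C2 [k2 [r20 r2d k20 H2]]]] := product_decay_minus hdelta dD disc2 hu2 hu2.
have [r3 [C3 [k3 [r30 r3d k30 H3]]]] := product_decay_plus hdelta dD disc2 hu3 hu3.
pose B := `|sigma|^-1 + `|alpha|^-1.
have Q2 : \forall z \near +oo, forall l, `|l| < r2 ->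
    `|- Omega_density sigma alpha c (u2 l) (u2 0) z| <= B * C2 * expR (- (k2 * z)).
  by apply: filterS H2 => z H l /H/Omega_density_le; rewrite normrN -mulrA; apply.
have Q3 : \forall z \near -oo, forall l, `|l| < r3 ->
    `|- Omega_density sigma alpha c (u3 l) (u3 0) z| <= B * C3 * expR (k3 * z).
  by apply: filterS H3 => z H l /H/Omega_density_le; rewrite normrN -mulrA; apply.
have G2p : G u2 z @[z --> +oo] --> 0.
  apply: (param_derive_decay r20 k20 _ F02 (dG _ pu2) Q2) => [l s lr|l lr].
    by apply: dF2; exact: lt_le_trans lr r2d.
  apply: (Omega_cvg0 (C := C2) _ (cvg_expRN k20)).
  by apply: filterS H2 => z; apply.
have G3m : G u3 z @[z --> -oo] --> 0.
  apply: (param_derive_decayN r30 k30 _ F03 (dG _ pu3) Q3) => [l s lr|l lr].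
    by apply: dF3; exact: lt_le_trans lr r3d.
  apply: (Omega_cvg0 (C := C3) _ (cvg_expR_Ny k30)).
  by apply: filterS H3 => z; apply.
pose J := G u2 0 - G u3 0.
have GJ z : G u2 z - G u3 z = J.
  apply: (@is_derive_0_is_cst _ (fun z => G u2 z - G u3 z)) => x.
  have := dG2 x; have := dG3 x; rewrite -u23 => d3 d2.
  by apply: is_derive_eq; rewrite subrr.
have dh (x : R) : is_derive x 1 (fun z => - G u2 z) (h x).
  have := dG2 x => d2; rewrite hE; apply: is_derive_eq; exact: opprK.
have ch : continuous h.
  have -> : h = Omega_density sigma alpha c (u2 0) (u2 0) by apply/funext.
  move=> x; apply/differentiable_continuous/derivable1_diffP.
  have X i := is_derive_coord i 0 (du2z x).
  rewrite /Omega_density; apply: ex_derive.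
(* The antiderivative -G2 of h tends to 0 at +oo; at -oo it tends to -J, because G2 = J + G3 and G3
   vanishes there. *)
have [ih Ih] : (@lebesgue_measure R).-integrable setT (EFin \o h) /\
    \int[@lebesgue_measure R]_x h x = 0 - - J.
  apply: (@integral_exp_decay _ h (fun z => - G u2 z) (B * C2) k2 (B * C3) k3) => //.
  - apply: filterS Q2 => z /(_ 0); rewrite normr0 => /(_ r20).
    by rewrite normrN -hE.
  - apply: filterS Q3 => z /(_ 0); rewrite normr0 => /(_ r30).
    by rewrite normrN -u23 -hE.
  - by rewrite -oppr0; exact: cvgN.
  - have -> : (fun z => - G u2 z) = (fun z => - (J + G u3 z)).
      by apply/funext => z; rewrite -(GJ z) subrK.
    apply: cvgN; rewrite -[X in _ --> X](addr0 J); apply: cvgD => //; exact: cvg_cst.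
split; [exact: ih|move=> z z'].
rewrite Ih sub0r opprK.
have O12 : Omega c (u1 0) (u2 0) z = 0.
  apply: (@cst_cvg_eq0 _ +oo%R _ _ (Omega_solutions_cst du1z du2z)).
  have [r [C [k [r0 _ k0 H]]]] := product_decay_minus hdelta dD disc2 hu1 hu2.
  apply: (Omega_cvg0 (C := C) _ (cvg_expRN k0)).
  by apply: filterS H => x; apply; rewrite normr0.
(* The order u4, u3 puts [nu2], whose discriminant is known to be positive, in second place;
   antisymmetry restores the order in [o34]. *)
have O43 : Omega c (u4 0) (u3 0) z = 0.
  apply: (@cst_cvg_eq0 _ -oo%R _ _ (Omega_solutions_cst du4z du3z)).
  have [r [C [k [r0 _ k0 H]]]] := product_decay_plus hdelta dD disc2 hu4 hu3.
  apply: (Omega_cvg0 (C := C) _ (cvg_expR_Ny k0)).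
  by apply: filterS H => x; apply; rewrite normr0.
(* Both constants are moved to the point z at which the Evans function is evaluated, so that an
   identity at one point remains. *)
rewrite (Omega_solutions_cst du1z du4z z' z) -(GJ z).
have o12 : omega (u1 0 z) (u2 0 z) = 0.
  by move/eqP: O12; rewrite mulf_eq0 gt_eqF ?expR_gt0 //= => /eqP.
have o34 : omega (u2 0 z) (u4 0 z) = 0.
  move/eqP: O43; rewrite mulf_eq0 gt_eqF ?expR_gt0 //= -u23 => /eqP o42.
  have -> : omega (u2 0 z) (u4 0 z) = - omega (u4 0 z) (u2 0 z) by rewrite /omega; ring.
  by rewrite o42 oppr0.
have o22 : omega (u2 0 z) (u2 0 z) = 0 by rewrite /omega; ring.
have E : evans c u1 u2 u3 u4 z = fun l => expR (2 * c * z) *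
    (omega (u1 l z) (u2 l z) * omega (u3 l z) (u4 l z)
     - omega (u1 l z) (u3 l z) * omega (u2 l z) (u4 l z)
     + omega (u1 l z) (u4 l z) * omega (u2 l z) (u3 l z)).
  by apply/funext => l; rewrite /evans det4E.
have d1 := dpsi _ _ (pu1 z); have d2 := dpsi _ _ (pu2 z).
have d3 := dpsi _ _ (pu3 z); have d4 := dpsi _ _ (pu4 z).
have o23 : omega (u2 0 z) (u3 0 z) = 0 by rewrite -u23 o22.
have o13 : omega (u1 0 z) (u3 0 z) = 0 by rewrite -u23 o12.
have o34' : omega (u3 0 z) (u4 0 z) = 0 by rewrite -u23 o34.
have H := is_derive_pfaffian (expR (2 * c * z))
  (is_derive_omega d1 d2) (is_derive_omega d3 d4) (is_derive_omega d1 d3)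
  (is_derive_omega d2 d4) (is_derive_omega d1 d4)
  (is_derive_omega d2 d3) o12 o34' o13 o34 o23.
rewrite E; apply: (is_derive_eq H).
rewrite /G -u23 /Omega.
(* One factor e^{cz} goes to Omega(u1, u4), the other to G2 - G3; the minus sign there comes from
   the antisymmetry of [omega]. *)
have -> : expR (2 * c * z) = expR (c * z) * expR (c * z).
  by rewrite -expRD; congr expR; ring.
have -> : omega (u2 0 z) (psi u3 z) = - omega (psi u3 z) (u2 0 z) by rewrite /omega; ring.
ring.
Qed.
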